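(* Let $X$ be a finite set partitioned as $X = X_1 \cup X_2$ with $X_1 \neq \emptyset$ and $X_2 \neq \emptyset$, and let $\mathcal{F} \subseteq 2^X$ be a 2-part intersecting system of maximum size. Then $$|\mathcal{F}| \le \frac{3}{8}\, 2^{|X|}.$$ This bound is best possible if $X_1$ or $X_2$ is a singleton (i.e. in that case there is a 2-part intersecting system of size exactly $\frac{3}{8}2^{|X|}$). Moreover, if $|X_1| = |X_2|$, then there exists a 2-part intersecting system $\mathcal{F} \subseteq 2^X$ of size $\frac{1}{3}\left(2^{|X|}+2\right)$.
   Context: A set system $\mathcal{H}$ is intersecting if $H_1 \cap H_2 \neq \emptyset$ for all $H_1, H_2 \in \mathcal{H}$. For $\mathcal{F} \subseteq 2^X$ with $X = X_1 \cup X_2$ a partition, and for $A \subseteq X_1$, $B \subseteq X_2$, define the trace systems $\mathcal{F}_A = \{F \cap X_2 : F \in \mathcal{F},\ F \cap X_1 = A\}$ and $\mathcal{F}_B = \{F \cap X_1 : F \in \mathcal{F},\ F \cap X_2 = B\}$. The system $\mathcal{F}$ is 2-part intersecting if for every $A \subseteq X_1$ the system $\mathcal{F}_A$ (of subsets of $X_2$) is intersecting and for every $B \subseteq X_2$ the system $\mathcal{F}_B$ (of subsets of $X_1$) is intersecting.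
   Formalization: ''Intersecting'' is required only for distinct H1, H2 (with H1 = H2 allowed, the 3/8 sharpness fails for singleton parts), and the 3/8 bound and its sharpness are stated for |X| ≥ 3, since for |X| = 2 the system {∅, X} has size 2 > 3/2. *)

(* Defs.v *)
From mathcomp Require Import all_boot.

Set Implicit Arguments.
Unset Strict Implicit.
Unset Printing Implicit Defensive.

(* Only distinct members are required to meet: a one-member system, [set set0]
   included, is intersecting. If set0 also had to meet itself, the traces on a
   singleton part would force #|F| <= 2 ^ #|T| / 4, and 3/8 would not be
   attained there. *)
Definition intersecting (T : finType) (H : {set {set T}}) : Prop :=
  forall H1 H2 : {set T},
    H1 \in H -> H2 \in H -> H1 != H2 -> H1 :&: H2 != set0.

(* The parts on Z of the members of F whose part on Y is A; for a partition
   {X1, X2}, F_A is trace_system F X1 X2 A and F_B is trace_system F X2 X1 B. *)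
Definition trace_system (T : finType) (F : {set {set T}}) (Y Z A : {set T}) :
    {set {set T}} :=
  [set S :&: Z | S in F & S :&: Y == A].

Definition two_part_intersecting (T : finType) (X1 X2 : {set T})
    (F : {set {set T}}) : Prop :=
  (forall A : {set T}, A \subset X1 -> intersecting (trace_system F X1 X2 A)) /\
  (forall B : {set T}, B \subset X2 -> intersecting (trace_system F X2 X1 B)).

Definition max_two_part_intersecting (T : finType) (X1 X2 : {set T})
    (F : {set {set T}}) : Prop :=
  two_part_intersecting X1 X2 F /\
  (forall G : {set {set T}}, two_part_intersecting X1 X2 G -> #|G| <= #|F|).

(* Main.v *)
(* For A in X1, a common member B of F_A and F_(X1 \ A) would put the disjoint
   sets A and X1 \ A in F_B.  So these two traces are disjoint intersecting
   families, and by Kleitman's theorem they have together at most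
   3/4 * 2 ^ #|X2| members; averaging over A gives 3/8.  Kleitman's theorem
   follows from Harris' inequality, applied to the two down-sets of the sets
   that contain no member of the first, respectively the second, family.
   If #|X1| = #|X2|, enumerate both parts and take the pairs (A, B) where A and
   B have the same largest index, together with (set0, set0): there are
   1 + (1 + 4 + ... + 4 ^ (#|X1| - 1)) of them. *)
Require Import Defs.
From mathcomp Require Import all_boot all_order all_algebra.
From mathcomp Require Import zify lra.

Set Implicit Arguments.
Unset Strict Implicit.
Unset Printing Implicit Defensive.

Import Order.TTheory GRing.Theory Num.Theory.

Section Subsets.
Variable T : finType.
Implicit Types (x y z : T) (A B D E S V X Y Z : {set T}) (F G : {set {set T}}).

(** * Sums over powersets and Harris' inequality *)

Lemma setU_powerset_inj V E : [disjoint V & E] ->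
  {in powerset E &, injective (setU V)}.
Proof.
move=> dVE A B; rewrite !powersetE => sA sB /(congr1 (setI E)).
rewrite !setIUr [E :&: V]setIC (disjoint_setI0 dVE) !set0U.
by rewrite (setIidPr sA) (setIidPr sB).
Qed.

Lemma card_setU_powerset V E : [disjoint V & E] ->
  #|[set V :|: S | S in powerset E]| = 2 ^ #|E|.
Proof.
move=> dVE; rewrite card_in_imset ?card_powerset //.
exact: setU_powerset_inj.
Qed.

Lemma big_powersetD1 x E (f : {set T} -> nat) : x \in E ->
  \sum_(S in powerset E) f S =
  \sum_(S in powerset (E :\ x)) f S + \sum_(S in powerset (E :\ x)) f (x |: S).
Proof.
move=> xE; rewrite (bigID (fun S => x \in S)) /= addnC; congr (_ + _).
  by apply: eq_bigl => S; rewrite !powersetE subsetD1.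
rewrite -(big_imset f (h := fun S => x |: S)) /=; last first.
  by apply: setU_powerset_inj; rewrite disjoints1 !inE eqxx.
apply: eq_bigl => S; rewrite powersetE.
apply/andP/imsetP => [[SE xS]|[S' + ->]].
  by exists (S :\ x); rewrite ?setD1K // powersetE setSD.
by rewrite powersetE subsetD1 setU11 subUset sub1set xE => /andP[-> _].
Qed.

(** Induction on [#|E|]: splitting at [x] gives half-sums F1 <= F0 and G1 <= G0, so (F0 + F1) (G0 +
    G1) <= 2 (F0 G0 + F1 G1), and the induction hypothesis bounds F0 G0 and F1 G1. *)
Lemma harris E (f g : {set T} -> nat) :
    {homo f : A B / A \subset B >-> B <= A} ->
    {homo g : A B / A \subset B >-> B <= A} ->
  (\sum_(S in powerset E) f S) * (\sum_(S in powerset E) g S)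
    <= 2 ^ #|E| * \sum_(S in powerset E) f S * g S.
Proof.
have [n] := ubnP #|E|; elim: n => // n IH in E f g * => ltEn hf hg.
have [->|[x xE]] := set_0Vmem E.
  by rewrite powerset0 !big_set1 cards0 mul1n.
rewrite !(big_powersetD1 _ xE) (cardsD1 x E) xE expnS.
have ltEx : #|E :\ x| < n by move: ltEn; rewrite (cardsD1 x E) xE.
have homoU (h : {set T} -> nat) : {homo h : A B / A \subset B >-> B <= A} ->
    {homo (fun S => h (x |: S)) : A B / A \subset B >-> B <= A}.
  by move=> hh A B sAB; apply/hh/setUS.
have sum_le (h : {set T} -> nat) : {homo h : A B / A \subset B >-> B <= A} ->
    \sum_(S in powerset (E :\ x)) h (x |: S)
      <= \sum_(S in powerset (E :\ x)) h S.
  by move=> hh; apply: leq_sum => S _; apply/hh/subsetUr.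
have := IH _ _ _ ltEx hf hg; have := IH _ _ _ ltEx (homoU _ hf) (homoU _ hg).
have := sum_le _ hf; have := sum_le _ hg; nia.
Qed.

(** * Complement-free families and Kleitman's theorem *)

Lemma setD_powerset_inj E : {in powerset E &, injective (setD E)}.
Proof.
have setDK A : A \subset E -> E :\: (E :\: A) = A.
  by move=> /setIidPr sA; rewrite setDDr setDv set0U sA.
by move=> A B; rewrite !powersetE => /setDK {2}<- /setDK {2}<- ->.
Qed.

(** [G] and the family of complements of its members are disjoint and equally large. *)
Lemma card_compl_free G E : G \subset powerset E ->
  {in G, forall S, E :\: S \notin G} -> 2 * #|G| <= 2 ^ #|E|.
Proof.
move=> sGE compl_free; rewrite -(card_powerset E) mul2n -addnn.
have cG : #|setD E @: G| = #|G|.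
  apply: card_in_imset => A B /(subsetP sGE) sA /(subsetP sGE) sB.
  exact: setD_powerset_inj.
rewrite -{2}cG -cardsUI (_ : G :&: _ = set0) ?cards0 ?addn0; last first.
  apply/setP => S; rewrite !inE; apply/negbTE/negP => /andP[+ /imsetP[S' S'G eS]].
  by rewrite eS (negbTE (compl_free _ S'G)).
apply/subset_leq_card; rewrite subUset sGE /=.
by apply/subsetP => _ /imsetP[S _ ->]; rewrite powersetE subsetDl.
Qed.

Lemma intersecting_compl G E : intersecting G -> E != set0 ->
  {in G, forall S, E :\: S \notin G}.
Proof.
move=> iG /set0Pn[x xE] S SG; apply/negP => CG.
have neq : S != E :\: S.
  by apply/eqP => /setP/(_ x); rewrite !inE xE andbT; case: (x \in S).
have /set0Pn[y] := iG _ _ SG CG neq.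
by rewrite !inE; case: (y \in S).
Qed.

(** The empty set meets no other member; this isolates the degenerate case of Kleitman's theorem. *)
Lemma intersecting_set0 G : intersecting G -> set0 \in G -> G = [set set0].
Proof.
move=> iG G0; apply/eqP; rewrite eqEsubset sub1set G0 andbT.
apply/subsetP => S SG; rewrite inE; apply/negP => /negP nS0.
by have := iG _ _ SG G0 nS0; rewrite setI0 eqxx.
Qed.

(** The subsets of [E] outside the up-set generated by [G]; they form a down-set. *)
Definition avoiding G E :=
  [set S in powerset E | [forall H in G, ~~ (H \subset S)]].

(** Two complementary sets cannot both contain members of [G]: these would be disjoint, hence equal,
    hence empty. So at most half of the subsets of [E] contain a member. *)
Lemma avoiding_card G E : intersecting G -> set0 \notin G ->
  2 ^ #|E| <= 2 * #|avoiding G E|.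
Proof.
move=> iG G0.
have sub : powerset E :\: avoiding G E \subset powerset E by exact: subsetDl.
have sA : avoiding G E \subset powerset E.
  by apply/subsetP => S; rewrite inE => /andP[].
have free : {in powerset E :\: avoiding G E,
    forall S, E :\: S \notin powerset E :\: avoiding G E}.
  have ex S : S \in powerset E :\: avoiding G E ->
      exists2 H, H \in G & H \subset S.
    rewrite !inE => /andP[+ sSE]; rewrite sSE negb_forall_in.
    by move=> /exists_inP[H HG]; rewrite negbK; exists H.
  move=> S /ex[H HG sHS]; apply/negP => /ex[H' H'G sH'S].
  have HH' : H :&: H' = set0.
    apply/setP => x; rewrite !inE; apply/negbTE/negP => /andP[xH xH'].
    by have := subsetP sH'S _ xH'; rewrite inE (subsetP sHS _ xH).
  have [eH|nH] := eqVneq H H'.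
    by move: HH'; rewrite -eH setIid => H0; rewrite -H0 HG in G0.
  by have := iG _ _ HG H'G nH; rewrite HH' eqxx.
have := card_compl_free sub free.
have := cardsID (avoiding G E) (powerset E).
rewrite (setIidPr sA) card_powerset.
(* Elaborating [{set {set T}}] inserts [reverse_coercion], which hides from [lia]
   that two cardinals are the same. *)
unfold reverse_coercion in *; lia.
Qed.

Lemma avoiding_harris G1 G2 E :
  #|avoiding G1 E| * #|avoiding G2 E|
    <= 2 ^ #|E| * #|avoiding G1 E :&: avoiding G2 E|.
Proof.
pose a G S : nat := [forall H in G, ~~ (H \subset S)].
have a_homo G : {homo a G : A B / A \subset B >-> B <= A}.
  move=> A B sAB; rewrite /a.
  case: (boolP [forall _ in _, _]) => // /forall_inP aB.
  rewrite lt0b; apply/forall_inP => H /aB; apply: contra => sHA.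
  exact: subset_trans sAB.
have sum_a G : \sum_(S in powerset E) a G S = #|avoiding G E|.
  rewrite -sum1dep_card big_mkcondr.
  by apply: eq_bigr => S _; rewrite /a; case: ifP.
have := harris E (a_homo G1) (a_homo G2); rewrite !sum_a.
suff -> : \sum_(S in powerset E) a G1 S * a G2 S
  = #|avoiding G1 E :&: avoiding G2 E| by [].
rewrite -sum1_card [RHS](eq_bigl (fun S => (S \in powerset E) &&
  ([forall H in G1, ~~ (H \subset S)] && [forall H in G2, ~~ (H \subset S)]))).
  by rewrite big_mkcondr; apply: eq_bigr => S _; rewrite /a mulnb; case: ifP.
by move=> S; rewrite !inE; case: (S \subset E).
Qed.

Lemma kleitman G1 G2 E : 1 < #|E| ->
    G1 \subset powerset E -> G2 \subset powerset E -> [disjoint G1 & G2] ->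
    intersecting G1 -> intersecting G2 ->
  4 * (#|G1| + #|G2|) <= 3 * 2 ^ #|E|.
Proof.
move=> ltE sG1 sG2 dG iG1 iG2.
have E0 : E != set0 by rewrite -card_gt0 ltnW.
have le4 : 4 <= 2 ^ #|E| by rewrite (@leq_exp2l 2 2).
have le1 := card_compl_free sG1 (intersecting_compl iG1 E0).
have le2 := card_compl_free sG2 (intersecting_compl iG2 E0).
(* A family containing [set0] has one member, at most a quarter of [2 ^ #|E|] since [1 < #|E|], and
   the other family has at most half. *)
have [G10|G10] := boolP (set0 \in G1).
  by move: le2; rewrite (intersecting_set0 iG1 G10) cards1; lia.
have [G20|G20] := boolP (set0 \in G2).
  by move: le1; rewrite (intersecting_set0 iG2 G20) cards1; lia.
have := avoiding_card E iG1 G10; have := avoiding_card E iG2 G20.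
have := avoiding_harris G1 G2 E.
set D := _ :&: _ => hD h1 h2.
(* Both down-sets have density at least 1/2, so by Harris' inequality [D] has density at least
   1/4. *)
have leD : 2 ^ #|E| <= 4 * #|D|.
  rewrite -(leq_pmul2l (m := 2 ^ #|E|)) ?expn_gt0 //.
  unfold reverse_coercion in *; nia.
have : #|(G1 :|: G2) :|: D| <= 2 ^ #|E|.
  rewrite -card_powerset subset_leq_card // !subUset sG1 sG2 /=.
  by apply/subsetP => S; rewrite !inE => /andP[/andP[]].
(* A member of either family contains itself, so it lies outside [D]. *)
have : [disjoint G1 :|: G2 & D].
  rewrite -setI_eq0; apply/eqP/setP => S; rewrite !inE; apply/negbTE.
  apply/negP => /and3P[SG /andP[_ /forall_inP a1] /andP[_ /forall_inP a2]].
  by case/orP: SG => [/a1|/a2]; rewrite subxx.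
move: dG; rewrite -!setI_eq0 => /eqP dG /eqP dGD.
have := cardsUI G1 G2; have := cardsUI (G1 :|: G2) D.
by rewrite dG dGD cards0; unfold reverse_coercion in *; lia.
Qed.

(** * Traces and the upper bound *)

(** Replaces traces by members of [F]: [A] disappears, being the common part on [Y] of the two
    members. *)
Lemma trace_intersectingP F Y Z :
  (forall A, A \subset Y -> intersecting (trace_system F Y Z A)) <->
  {in F &, forall S1 S2, S1 :&: Y = S2 :&: Y -> S1 :&: Z != S2 :&: Z ->
     exists2 z, z \in Z & (z \in S1) && (z \in S2)}.
Proof.
split=> [iF S1 S2 S1F S2F eY nZ|iF A _ H1 H2].
  have tr S : S \in F -> S :&: Y = S1 :&: Y ->
      S :&: Z \in trace_system F Y Z (S1 :&: Y).
    by move=> SF eS; apply: imset_f; rewrite inE SF eS eqxx.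
  have [tr1 tr2] := (tr _ S1F erefl, tr _ S2F (esym eY)).
  have /set0Pn[z] := iF _ (subsetIr S1 Y) _ _ tr1 tr2 nZ.
  rewrite !inE => /andP[/andP[zS1 zZ] /andP[zS2 _]].
  by exists z; rewrite ?zS1.
move=> /imsetP[S1 + ->] /imsetP[S2 + ->]; rewrite !inE.
move=> /andP[S1F /eqP e1] /andP[S2F /eqP e2] nZ.
have [|z zZ /andP[z1 z2]] := iF _ _ S1F S2F _ nZ; first by rewrite e1.
by apply/set0Pn; exists z; rewrite !inE z1 z2 zZ.
Qed.

Lemma two_part_intersectingC X1 X2 F :
  two_part_intersecting X1 X2 F -> two_part_intersecting X2 X1 F.
Proof. by case. Qed.

Section Partition.
Variables X1 X2 : {set T}.
Hypotheses (hcover : X1 :|: X2 = [set: T]) (hdisj : [disjoint X1 & X2]).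

Lemma partition_split S : S = (S :&: X1) :|: (S :&: X2).
Proof. by rewrite -setIUr hcover setIT. Qed.

Lemma cardT_partition : #|T| = #|X1| + #|X2|.
Proof.
by have := cardsUI X1 X2; rewrite hcover cardsT disjoint_setI0 ?cards0 ?addn0.
Qed.

Lemma card_trace_sum F :
  #|F| = \sum_(A in powerset X1) #|trace_system F X1 X2 A|.
Proof.
rewrite -sum1_card.
rewrite (partition_big (fun S => S :&: X1) (mem (powerset X1))) /=; last first.
  by move=> S _; rewrite powersetE subsetIr.
apply: eq_bigr => A _; rewrite sum1dep_card card_in_imset //.
move=> S1 S2; rewrite !inE => /andP[_ /eqP e1] /andP[_ /eqP e2] e.
by rewrite [S1]partition_split [S2]partition_split e1 e2 e.
Qed.

Lemma trace_compl_disjoint F A : two_part_intersecting X1 X2 F -> X1 != set0 ->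
  [disjoint trace_system F X1 X2 A & trace_system F X1 X2 (X1 :\: A)].
Proof.
move=> [_ /trace_intersectingP iF] /set0Pn[x xX1].
rewrite -setI_eq0; apply/eqP/setP => B; rewrite [RHS]inE; apply/negbTE/negP.
move=> /setIP[/imsetP[S1 + eB1] /imsetP[S2 + eB2]]; rewrite !inE.
move=> /andP[S1F /eqP e1] /andP[S2F /eqP e2].
have [||z zX1 /andP[z1 z2]] := iF _ _ S1F S2F; first by rewrite -eB1.
  (* The point [x] of [X1] lies in exactly one of [A] and [X1 :\: A], so these are distinct. *)
  apply/eqP => /setP/(_ x); rewrite e1 e2 !inE xX1 andbT.
  by case: (x \in A).
have : z \in S1 :&: X1 by rewrite inE z1.
have : z \in S2 :&: X1 by rewrite inE z2.
by rewrite e1 e2 inE => /andP[/negbTE ->].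
Qed.

Lemma two_part_intersecting_card F : two_part_intersecting X1 X2 F ->
  X1 != set0 -> 1 < #|X2| -> 8 * #|F| <= 3 * 2 ^ #|T|.
Proof.
move=> iF X10 X2gt1.
(* Complementation permutes the subsets of [X1], so pairing each trace with the complementary one
   counts [F] twice: the factor 4 of Kleitman's theorem becomes 8. *)
have compl : #|F| = \sum_(A in powerset X1) #|trace_system F X1 X2 (X1 :\: A)|.
  rewrite card_trace_sum -(big_imset (fun A => #|trace_system F X1 X2 A|)
    (@setD_powerset_inj X1)) /=.
  apply: eq_bigl => A; apply/idP/imsetP => [|[A' _ ->]].
    rewrite powersetE => sA; exists (X1 :\: A).
      by rewrite powersetE subsetDl.
    by rewrite setDDr setDv set0U (setIidPr sA).
  by rewrite powersetE subsetDl.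
have : \sum_(A in powerset X1)
    4 * (#|trace_system F X1 X2 A| + #|trace_system F X1 X2 (X1 :\: A)|)
    <= \sum_(A in powerset X1) 3 * 2 ^ #|X2|.
  apply: leq_sum => A; rewrite powersetE => sA.
  have sub B : trace_system F X1 X2 B \subset powerset X2.
    by apply/subsetP => _ /imsetP[S _ ->]; rewrite powersetE subsetIr.
  apply: kleitman => //; first exact: trace_compl_disjoint.
    exact: iF.1.
  by apply: iF.1; apply: subsetDl.
rewrite -big_distrr /= big_split /= -card_trace_sum -compl sum_nat_const.
by rewrite card_powerset cardT_partition expnD mulnCA addnn -mul2n mulnA.
Qed.

(** * Sharpness when one part is a singleton *)

(** With X1 = {x} and distinct y, z in X2, take the sets with y but not x, a quarter of all, and the
    sets with x and z but not y, an eighth. *)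
Lemma two_part_intersecting_singleton : #|X1| = 1 -> 1 < #|X2| ->
  exists2 F, two_part_intersecting X1 X2 F & 8 * #|F| = 3 * 2 ^ #|T|.
Proof.
move=> /eqP/cards1P[x eX1] /card_gt1P[y [z [yX2 zX2 nyz]]].
have X2x w : w \in X2 -> w != x.
  by move=> wX2; apply: contraTneq wX2 => ->;
    have := disjointFr hdisj (x := x); rewrite eX1 inE eqxx => ->.
have [nyx nzx] := (X2x _ yX2, X2x _ zX2).
pose F0 := [set [set y] :|: S | S in powerset (~: [set x; y])].
pose F1 := [set [set x; z] :|: S | S in powerset (~: [set x; y; z])].
have F0P S : S \in F0 -> (x \notin S) && (y \in S).
  move=> /imsetP[S' + ->]; rewrite powersetE => /subsetP sS.
  rewrite !inE eqxx andbT eq_sym (negbTE nyx) /=.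
  by apply/negP => /sS; rewrite !inE eqxx.
have F1P S : S \in F1 -> [&& x \in S, z \in S & y \notin S].
  move=> /imsetP[S' + ->]; rewrite powersetE => /subsetP sS.
  rewrite !inE !eqxx (negbTE nyx) (negbTE nyz) orbT /=.
  by apply/negP => /sS; rewrite !inE eqxx orbT.
exists (F0 :|: F1); first (split; apply/trace_intersectingP => S1 S2).
(* Equal parts on [X1] put both members in [F0], where they share [y], or both in [F1], where they
   share [z]. *)
- move=> S1F S2F /setP/(_ x); rewrite eX1 !inE eqxx !andbT => ex _.
  move: S1F S2F; rewrite !inE.
  case/orP=> [/F0P/andP[x1 y1]|/F1P/and3P[x1 z1 _]];
  case/orP=> [/F0P/andP[x2 y2]|/F1P/and3P[x2 z2 _]].
  + by exists y; rewrite ?y1.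
  + by move: x1; rewrite ex x2.
  + by move: x2; rewrite -ex x1.
  + by exists z; rewrite ?z1.
(* The point [y] tells [F0] from [F1] and thereby decides whether [x] belongs: members with the same
   part on [X2] coincide on [X1]. *)
- move=> S1F S2F /setP/(_ y); rewrite !inE yX2 !andbT => ey nX1.
  have : (x \in S1) != (x \in S2).
    apply: contraNneq nX1 => ex; apply/eqP/setP => w; rewrite eX1 !inE.
    by case: eqP => [->|]; rewrite ?andbF // ex.
  move: S1F S2F ey; rewrite !inE.
  case/orP=> [/F0P/andP[/negbTE-> ->]|/F1P/and3P[-> _ /negbTE->]];
  by case/orP=> [/F0P/andP[/negbTE-> ->]|/F1P/and3P[-> _ /negbTE->]].
have d0 : [disjoint [set y] & ~: [set x; y]].
  by rewrite disjoints1 !inE eqxx orbT.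
have d1 : [disjoint [set x; z] & ~: [set x; y; z]].
  rewrite disjoints_subset setCK; apply/subsetP => w.
  by rewrite !inE => /orP[]->; rewrite ?orbT.
have F01 : F0 :&: F1 = set0.
  apply/setP => S; rewrite !inE; apply/negbTE/negP.
  by move=> /andP[/F0P/andP[/negbTE xS _] /F1P/andP[]]; rewrite xS.
have := cardsUI F0 F1; rewrite F01 cards0 addn0 => ->.
rewrite !card_setU_powerset //.
have := cardsC [set x; y]; have := cardsC [set x; y; z].
rewrite -setUA cardsU1 !cards2 !inE nyz.
rewrite ![x == _]eq_sym (negbTE nyx) (negbTE nzx) /=.
move=> <- e2; have -> : #|~: [set x; y]| = #|~: (x |: [set y; z])|.+1 by lia.
by rewrite !expnD expnS; lia.
Qed.

End Partition.

(** * Two parts of equal size *)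

(** Remove [x] from [X1] and [y] from [X2], and add to a family for the rest all sets containing
    both points. The family is confined to subsets of [X1 :|: X2], so that the induction can shrink
    the parts inside the same type. *)
Lemma two_part_intersecting_equal X1 X2 :
    [disjoint X1 & X2] -> #|X1| = #|X2| ->
  exists F, [/\ F \subset powerset (X1 :|: X2), two_part_intersecting X1 X2 F
    & 3 * #|F| = 2 ^ (#|X1| + #|X2|) + 2].
Proof.
move: {2}#|X1| (erefl #|X1|) => n; elim: n => [|n IH] in X1 X2 *.
  move=> /eqP; rewrite cards_eq0 => /eqP -> _; rewrite cards0 => /esym/eqP.
  (* Both parts are empty, and one member suffices: 3 = 2^0 + 2. *)
  rewrite cards_eq0 => /eqP ->; exists [set set0].
  rewrite cards1 cards0 sub1set powersetE sub0set; split => //.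
  by split=> A _ H1 H2 /imsetP[S1 _ ->] /imsetP[S2 _ ->]; rewrite !setI0 eqxx.
move=> cX1 dX eX; have [x xX1] : exists x, x \in X1.
  by apply/set0Pn; rewrite -card_gt0 cX1.
have [y yX2] : exists y, y \in X2.
  by apply/set0Pn; rewrite -card_gt0 -eX cX1.
have [xX2 yX1] := (disjointFr dX xX1, disjointFl dX yX2).
set Y1 := X1 :\ x; set Y2 := X2 :\ y.
have cY1 : #|X1| = #|Y1|.+1 by rewrite (cardsD1 x) xX1.
have cY2 : #|X2| = #|Y2|.+1 by rewrite (cardsD1 y) yX2.
have dY : [disjoint Y1 & Y2].
  by apply: disjointWl (subsetDl _ _) _; apply: disjointWr (subsetDl _ _) _.
have [|||F [sF [iF1 iF2] cF]] := IH Y1 Y2.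
- lia.
- exact: dY.
- lia.
have /trace_intersectingP i1 := iF1; have /trace_intersectingP i2 := iF2.
pose G := [set [set x; y] :|: S | S in powerset (Y1 :|: Y2)].
have xyY : [disjoint [set x; y] & Y1 :|: Y2].
  rewrite -setI_eq0; apply/eqP/setP => w; rewrite !inE.
  by case: eqP => [->|_]; case: eqP => [->|_];
    rewrite ?eqxx ?xX1 ?xX2 ?yX1 ?yX2 ?andbF.
have GP S : S \in G -> (x \in S) && (y \in S).
  by move=> /imsetP[S' _ ->]; rewrite !inE !eqxx orbT.
(* Sets of the smaller family miss [x] and [y], so enlarging the parts does not change their
   traces. *)
have FP S : S \in F -> [/\ x \notin S, y \notin S, S :&: X1 = S :&: Y1
    & S :&: X2 = S :&: Y2].
  move=> /(subsetP sF); rewrite powersetE => sS.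
  have nS w : w \in [set x; y] -> w \notin S.
    by move=> /(disjointFr xyY) h; apply: contraFN h => /(subsetP sS).
  have [xS yS] : x \notin S /\ y \notin S.
    by split; apply: nS; rewrite !inE eqxx ?orbT.
  by split=> //; apply/setP => w; rewrite !inE; case: eqP => // ->;
    rewrite ?(negbTE xS) ?(negbTE yS).
exists (F :|: G); split.
- rewrite subUset; apply/andP; split; apply/subsetP => S.
    move=> /(subsetP sF); rewrite !powersetE => /subset_trans; apply.
    by apply: setUSS; apply: subsetDl.
  move=> /imsetP[S' + ->]; rewrite !powersetE => sS'.
  rewrite !subUset !sub1set !inE xX1 yX2 orbT /=.
  by apply: subset_trans sS' _; apply: setUSS; apply: subsetDl.
- split; apply/trace_intersectingP => S1 S2; rewrite !inE.
  (* The point [x] separates [F] from [G]: with equal parts on [X1], both sets lie in [F], where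
     induction applies, or both in [G], where they share [y]. The other condition is symmetric. *)
  + move=> S1F S2F e neq.
    have := congr1 (fun A => x \in A) e; rewrite /= !inE xX1 !andbT => ex.
    case/orP: S1F => [S1F|/GP/andP[x1 y1]];
      case/orP: S2F => [S2F|/GP/andP[x2 y2]].
    * have [_ _ e11 e12] := FP _ S1F; have [_ _ e21 e22] := FP _ S2F.
      move: e neq; rewrite e11 e12 e21 e22 => e neq.
      have [z] := i1 _ _ S1F S2F e neq; rewrite inE => /andP[_ zX2] ?.
      by exists z.
    * by have [] := FP _ S1F; rewrite ex x2.
    * by have [] := FP _ S2F; rewrite -ex x1.
    * by exists y => //; rewrite y1.
  + move=> S1F S2F e neq.
    have := congr1 (fun A => y \in A) e; rewrite /= !inE yX2 !andbT => ey.
    case/orP: S1F => [S1F|/GP/andP[x1 y1]];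
      case/orP: S2F => [S2F|/GP/andP[x2 y2]].
    * have [_ _ e11 e12] := FP _ S1F; have [_ _ e21 e22] := FP _ S2F.
      move: e neq; rewrite e11 e12 e21 e22 => e neq.
      have [z] := i2 _ _ S1F S2F e neq; rewrite inE => /andP[_ zX1] ?.
      by exists z.
    * by have [_] := FP _ S1F; rewrite ey y2.
    * by have [_] := FP _ S2F; rewrite -ey y1.
    * by exists x => //; rewrite x1.
have FG : F :&: G = set0.
  apply/setP => S; rewrite !inE; apply/negbTE/negP.
  by move=> /andP[/FP[/negbTE xS _ _ _] /GP]; rewrite xS.
have := cardsUI F G; rewrite FG cards0 addn0 => ->.
have := cardsUI Y1 Y2; rewrite (disjoint_setI0 dY) cards0 addn0 => cY.
have -> : #|X1| + #|X2| = (#|Y1| + #|Y2|).+2 by lia.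
(* With n = [#|Y1|], [G] has 4^n members, and (4^n + 2) + 3 4^n = 4^(n+1) + 2. *)
by rewrite card_setU_powerset // cY mulnDr cF !expnS; lia.
Qed.

End Subsets.

(** * The three claims over the rationals *)

Local Open Scope ring_scope.

(** If both parts are singletons, the empty set and the whole set form a 2-part intersecting system
    of size 2 > 3/8 4; hence [2 < #|T|] in the first two claims. *)
Theorem theorem2 (T : finType) (X1 X2 : {set T})
    (hcover : X1 :|: X2 = [set: T]) (hdisj : [disjoint X1 & X2])
    (hX1 : X1 != set0) (hX2 : X2 != set0) :
  ((2 < #|T|)%N ->
    forall F : {set {set T}}, max_two_part_intersecting X1 X2 F ->
      #|F|%:R <= 3 / 8 * 2 ^+ #|T| :> rat) /\
  ((2 < #|T|)%N -> #|X1| = 1%N \/ #|X2| = 1%N ->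
    exists F : {set {set T}}, two_part_intersecting X1 X2 F /\
      #|F|%:R = 3 / 8 * 2 ^+ #|T| :> rat) /\
  (#|X1| = #|X2| ->
    exists F : {set {set T}}, two_part_intersecting X1 X2 F /\
      #|F|%:R = 1 / 3 * (2 ^+ #|T| + 2) :> rat).
Proof.
have cT := cardT_partition hcover hdisj.
have hcover' : X2 :|: X1 = [set: T] by rewrite setUC.
have hdisj' : [disjoint X2 & X1] by rewrite disjoint_sym.
split=> [ltT F [iF _]|]; last split=> [ltT X_1|eX].
- have : (8 * #|F| <= 3 * 2 ^ #|T|)%N.
    (* Of more than two points, some part holds at least two; that part takes the role of [X2]. *)
    have [X2gt1|X2le1] := ltnP 1 #|X2|.
      exact: (two_part_intersecting_card hcover hdisj).
    apply: (two_part_intersecting_card hcover' hdisj') => //.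
      exact: two_part_intersectingC.
    lia.
  by rewrite -(ler_nat rat) !natrM natrX; lra.
- have [F iF cF] : exists2 F, two_part_intersecting X1 X2 F
      & (8 * #|F| = 3 * 2 ^ #|T|)%N.
    case: X_1 => X_1.
      by apply: (two_part_intersecting_singleton hdisj); lia.
    have [||F iF cF] := two_part_intersecting_singleton hdisj'; try lia.
    by exists F => //; apply: two_part_intersectingC.
  exists F; split=> //; move/(congr1 (fun n => n%:R : rat)): cF.
  by rewrite !natrM natrX; lra.
- have [F [_ iF cF]] := two_part_intersecting_equal hdisj eX.
  exists F; split=> //; move/(congr1 (fun n => n%:R : rat)): cF.
  by rewrite -cT natrD natrM natrX; lra.
Qed.
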